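(* Let $n\ge 1$, $\sigma>\nu>0$, and let $m_3$, $t$, $b^{(ij)}$ be as defined in the context. Let $s^*\in\mathbb{R}^n$ satisfy $\nabla m_3(s^* )=0$ and $$B(s^* ):=H+T[s^*]+\sigma\|s^*\|^2I_n-\nu\big(\|s^*\|^2I_n-s^*{s^*}^T\big)-\frac{2}{\sigma-\nu}\,tt^T-2\big(s^*t^T+t{s^*}^T\big)-\sum_{1\le i<j\le n}\Big(\tilde s^{(ij)}{b^{(ij)}}^T+b^{(ij)}{\tilde s^{(ij)}}{}^T+\frac1\nu b^{(ij)}{b^{(ij)}}^T\Big)\succeq 0,$$ where $\tilde s^{(ij)}\in\mathbb{R}^n$ has $s^*_j$ as its $i$-th entry, $s^*_i$ as its $j$-th entry, and all other entries zero. Then $q(v):=m_3(s^*+v)-m_3(s^* )$ is a sum of squares of polynomials in $v$, and consequently $s^*$ is a global minimizer of $m_3$ over $\mathbb{R}^n$.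
   Context: Let $f_0\in\mathbb{R}$, $g\in\mathbb{R}^n$, $H\in\mathbb{R}^{n\times n}$ symmetric, $T\in\mathbb{R}^{n\times n\times n}$ a symmetric third-order tensor, $\sigma>0$. Notation: $H[s]^2=s^THs$; $T[s]^3=\sum_{i,j,k}T_{ijk}s_is_js_k$; $T[s]$ is the $n\times n$ matrix with entries $\sum_kT_{ijk}s_k$; $\|\cdot\|$ is the Euclidean norm; $I_n$ is the identity; $\succeq 0$ means positive semidefinite. The quartically regularized cubic model is $$m_3(s)=f_0+g^Ts+\tfrac12H[s]^2+\tfrac16T[s]^3+\tfrac{\sigma}{4}\|s\|^4,\qquad s\in\mathbb{R}^n.$$ The vectors $t\in\mathbb{R}^n$ and $b^{(ij)}\in\mathbb{R}^n$ ($1\le i<j\le n$) are defined by $t_i=\tfrac16T_{iii}$ and $$b^{(ij)}_i=\tfrac12T_{iij}-\tfrac16T_{jjj},\qquad b^{(ij)}_j=\tfrac12T_{ijj}-\tfrac16T_{iii},\qquad b^{(ij)}_k=\tfrac13T_{ijk}\ \ (k\ne i,j),$$ so that $\tfrac16T[v]^3=\big(\sum_{i}v_i^2\big)(t^Tv)+\sum_{1\le i<j\le n}v_iv_j\,\big(v^Tb^{(ij)}\big)$ for all $v\in\mathbb{R}^n$. *)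

(* Defs.v *)
From mathcomp Require Import all_boot all_order all_algebra.
From mathcomp Require Import reals topology normedtype derive.
(* mpoly is not imported: its notations clash with those of the analysis
   library. *)
From mathcomp Require mpoly.

Set Implicit Arguments.
Unset Strict Implicit.
Unset Printing Implicit Defensive.

Import Order.TTheory GRing.Theory Num.Theory.
Import numFieldNormedType.Exports.

Local Open Scope ring_scope.

(* The library norm on matrices is the sup norm, so the Euclidean norm is
   defined here.  Both norms induce the same topology, hence the same
   derivatives. *)
Definition enorm (R : realType) (n : nat) (s : 'cV[R]_n) : R :=
  Num.sqrt (\sum_i s i 0 ^+ 2).

Definition dotv (R : realType) (n : nat) (u v : 'cV[R]_n) : R :=
  (u^T *m v) 0 0.

(* H[s]^2 *)
Definition quadf (R : realType) (n : nat) (H : 'M[R]_n) (s : 'cV[R]_n) : R :=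
  (s^T *m H *m s) 0 0.

Definition psdmx (R : realType) (n : nat) (A : 'M[R]_n) : Prop :=
  A^T = A /\ forall v : 'cV[R]_n, 0 <= quadf A v.

Definition tensor3 (R : realType) (n : nat) : Type :=
  'I_n -> 'I_n -> 'I_n -> R.

(* These two transpositions of the indices generate all permutations. *)
Definition symtensor3 (R : realType) (n : nat) (T : tensor3 R n) : Prop :=
  forall i j k : 'I_n, T i j k = T j i k /\ T i j k = T i k j.

(* T[s] *)
Definition tensor_mx (R : realType) (n : nat) (T : tensor3 R n)
    (s : 'cV[R]_n) : 'M[R]_n :=
  \matrix_(i, j) \sum_k T i j k * s k 0.

(* T[s]^3 *)
Definition cubicf (R : realType) (n : nat) (T : tensor3 R n)
    (s : 'cV[R]_n) : R :=
  \sum_i \sum_j \sum_k T i j k * s i 0 * s j 0 * s k 0.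

Definition m3 (R : realType) (n : nat) (f0 : R) (g : 'cV[R]_n) (H : 'M[R]_n)
    (T : tensor3 R n) (sigma : R) (s : 'cV[R]_n) : R :=
  f0 + dotv g s + 2^-1 * quadf H s + 6^-1 * cubicf T s
  + sigma / 4 * enorm s ^+ 4.

Definition gradient (R : realType) (n : nat) (f : 'cV[R]_n -> R)
    (s : 'cV[R]_n) : 'cV[R]_n :=
  \col_i 'D_(delta_mx i 0) f s.

Definition tvec (R : realType) (n : nat) (T : tensor3 R n) : 'cV[R]_n :=
  \col_i (T i i i / 6).

(* b^(ij), meant for i != j *)
Definition bvec (R : realType) (n : nat) (T : tensor3 R n) (i j : 'I_n) :
    'cV[R]_n :=
  \col_k (if k == i then T i i j / 2 - T j j j / 6
          else if k == j then T i j j / 2 - T i i i / 6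
          else T i j k / 3).

(* s~^(ij), meant for i != j *)
Definition swapvec (R : realType) (n : nat) (s : 'cV[R]_n) (i j : 'I_n) :
    'cV[R]_n :=
  \col_k (if k == i then s j 0 else if k == j then s i 0 else 0).

Definition Bmx (R : realType) (n : nat) (H : 'M[R]_n) (T : tensor3 R n)
    (sigma nu : R) (s : 'cV[R]_n) : 'M[R]_n :=
  let t := tvec T in
  H + tensor_mx T s + (sigma * enorm s ^+ 2)%:M
  - nu *: ((enorm s ^+ 2)%:M - s *m s^T)
  - (2 / (sigma - nu)) *: (t *m t^T)
  - 2 *: (s *m t^T + t *m s^T)
  - \sum_(i < n) \sum_(j < n | (i < j)%N)
      let b := bvec T i j in
      let st := swapvec s i j in
      (st *m b^T + b *m st^T + nu^-1 *: (b *m b^T)).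

Definition is_sos (R : realType) (n : nat) (q : 'cV[R]_n -> R) : Prop :=
  exists ps : seq (mpoly.mpoly n R),
    forall v : 'cV[R]_n,
      q v = \sum_(p <- ps) mpoly.meval (fun i : 'I_n => v i 0) p ^+ 2.

(* Main.v *)
Require Import Defs.
From mathcomp Require Import all_boot all_order all_algebra.
From mathcomp Require Import classical_sets reals topology normedtype derive.
From mathcomp Require Import(canonicals) mpoly.
From mathcomp Require Import ring zify.

(** The theorem follows from an explicit certificate.  Write x.y for the dot
    product, s for the critical point, t for tvec T, b_ij for bvec T i j and
    B for Bmx H T sigma nu s.  Since the model is a quartic polynomial, its
    increment at s is an exact Taylor expansion; its linear part is the
    gradient, which vanishes.  What is left equals, for every v,

      B[v]^2 / 2
      + (t.v + (sigma - nu) (s.v + |v|^2 / 2))^2 / (sigma - nu)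
      + sum_(i<j) (b_ij.v + nu (s_j v_i + s_i v_j + v_i v_j))^2 / (2 nu)
      + nu / 4 * sum_i (2 s_i v_i + v_i^2)^2.

    The second and third lines complete the squares that absorb the cubic
    terms of v, once these are written as
    |v|^2 (t.v) + sum_(i<j) v_i v_j (b_ij.v) (lemma cubicf_decomp).  Completing
    them costs the pure squares (sigma - nu) (s.v + |v|^2 / 2)^2 and
    nu (s_j v_i + s_i v_j + v_i v_j)^2 / 2.  The terms of the model that carry
    sigma provide sigma (s.v + |v|^2 / 2)^2, which leaves
    nu (s.v + |v|^2 / 2)^2 for the squares indexed by pairs.  Together with the
    term in nu (|s|^2 I - s s^T) of B it pays for half their sum over all
    (i, j), because that sum factors into dot products.  The sum over i < j is
    smaller by half the diagonal terms, and these are the squares of the last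
    line (lemma sum_pair_squares).  The identity is lemma m3_certificate.

    The first line is a sum of squares of linear forms because B is positive
    semidefinite: symmetric elimination, lemma psdmx_sos.  The other lines are
    squares of polynomials with nonnegative weights as 0 < nu < sigma.
    Global minimality is the nonnegativity of a sum of squares. *)

Set Implicit Arguments.
Unset Strict Implicit.
Unset Printing Implicit Defensive.

Import Order.TTheory GRing.Theory Num.Theory.
Import numFieldNormedType.Exports.

Local Open Scope ring_scope.

(** * Bilinear and quadratic forms *)

Section Forms.
Variables (R : realType) (n : nat).
Implicit Types (u v w x y s : 'cV[R]_n) (A M : 'M[R]_n) (T : tensor3 R n).

Lemma dotvE u v : dotv u v = \sum_i u i 0 * v i 0.
Proof. by rewrite /dotv !mxE; apply: eq_bigr => i _; rewrite mxE. Qed.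

Lemma dotvC u v : dotv u v = dotv v u.
Proof. by rewrite !dotvE; apply: eq_bigr => i _; rewrite mulrC. Qed.

Lemma dotvDr u v w : dotv u (v + w) = dotv u v + dotv u w.
Proof. by rewrite /dotv mulmxDr mxE. Qed.

Lemma dotvDl u v w : dotv (u + v) w = dotv u w + dotv v w.
Proof. by rewrite dotvC dotvDr !(dotvC w). Qed.

Lemma dotvZr a u v : dotv u (a *: v) = a * dotv u v.
Proof. by rewrite /dotv -scalemxAr mxE. Qed.

Lemma dotvZl a u v : dotv (a *: u) v = a * dotv u v.
Proof. by rewrite dotvC dotvZr dotvC. Qed.

Lemma dotv_mulmx A x y : dotv x (A *m y) = dotv (A^T *m x) y.
Proof. by rewrite /dotv trmx_mul trmxK mulmxA. Qed.

Lemma dotv_delta u i : dotv u (delta_mx i 0) = u i 0.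
Proof.
rewrite dotvE (bigD1 i) //= mxE !eqxx mulr1 big1 ?addr0 // => j ji.
by rewrite mxE (negbTE ji) mulr0.
Qed.

Lemma enorm_sqr s : enorm s ^+ 2 = dotv s s.
Proof.
rewrite /enorm sqr_sqrtr ?sumr_ge0 // => [|i _]; last exact: sqr_ge0.
by rewrite dotvE; apply: eq_bigr => i _; rewrite expr2.
Qed.

Lemma quadfE A v : quadf A v = dotv v (A *m v).
Proof. by rewrite /quadf /dotv mulmxA. Qed.

Lemma quadfDl A M v : quadf (A + M) v = quadf A v + quadf M v.
Proof. by rewrite !quadfE mulmxDl dotvDr. Qed.

Lemma quadfZl a A v : quadf (a *: A) v = a * quadf A v.
Proof. by rewrite !quadfE -scalemxAl dotvZr. Qed.

Lemma quadfNl A v : quadf (- A) v = - quadf A v.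
Proof. by rewrite -scaleN1r quadfZl mulN1r. Qed.

Lemma quadf0l v : quadf 0 v = 0.
Proof. by rewrite -(scale0r 0) quadfZl mul0r. Qed.

Lemma quadf_sum (I : Type) (r : seq I) (P : pred I) (F : I -> 'M[R]_n) v :
  quadf (\sum_(i <- r | P i) F i) v = \sum_(i <- r | P i) quadf (F i) v.
Proof.
apply: (big_morph (fun A => quadf A v)) => [A M|]; first exact: quadfDl.
exact: quadf0l.
Qed.

Lemma quadf_scalar a v : quadf a%:M v = a * dotv v v.
Proof. by rewrite quadfE mul_scalar_mx dotvZr. Qed.

Lemma quadf_outer u w v : quadf (u *m w^T) v = dotv u v * dotv w v.
Proof.
rewrite quadfE -mulmxA [w^T *m v]mx11_scalar -/(dotv w v) mul_mx_scalar.
by rewrite dotvZr mulrC dotvC.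
Qed.

Lemma quadfZr a A v : quadf A (a *: v) = a ^+ 2 * quadf A v.
Proof. by rewrite !quadfE -scalemxAr dotvZr dotvZl mulrA expr2. Qed.

Lemma quadfD A x y : A^T = A ->
  quadf A (x + y) = quadf A x + 2 * dotv (A *m x) y + quadf A y.
Proof.
move=> symA; rewrite !quadfE mulmxDr !dotvDl !dotvDr.
rewrite (dotv_mulmx A x y) symA (dotvC y (A *m x)); ring.
Qed.

(** * Positive semidefinite quadratic forms are sums of squares *)

Lemma mulmx_delta A i j : (A *m delta_mx i (0 : 'I_1)) j 0 = A j i.
Proof. by rewrite -colE mxE. Qed.

Lemma symmxE A i j : A^T = A -> A i j = A j i.
Proof. by move=> symA; rewrite -{1}symA mxE. Qed.

Lemma quadf_delta A i : quadf A (delta_mx i 0) = A i i.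
Proof. by rewrite quadfE dotvC dotv_delta mulmx_delta. Qed.

(** Otherwise the form would be affine and nonconstant, hence somewhere
    negative, along the line through the j-th basis vector directed by the
    i-th one. *)
Lemma psdmx_row0 A i j : psdmx A -> A i i = 0 -> A i j = 0.
Proof.
move=> [symA psdA] Aii; apply/eqP; apply: contraT => Aij.
(* h is chosen so that the form takes the value -1. *)
pose h := - (A j j + 1) / (2 * A i j).
have := psdA (h *: delta_mx i 0 + delta_mx j 0).
rewrite quadfD // quadfZr !quadf_delta Aii mulr0 add0r -scalemxAr dotvZl.
rewrite dotv_delta mulmx_delta (symmxE j i symA).
have -> : 2 * (h * A i j) + A j j = -1 by rewrite /h; field.
by rewrite lerNr oppr0 ler10.
Qed.

(** Symmetric Gaussian elimination, from the last row upwards.  A nonzero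
    pivot A i i splits off the square of the linear form of column i, divided
    by the pivot; what remains is still positive semidefinite, being the
    minimum of the form over the translates of its argument along the i-th
    basis vector. *)
Lemma psdmx_sos_rec k A :
    psdmx A -> (forall i j : 'I_n, (k <= i)%N -> A i j = 0) ->
  exists us : seq 'cV[R]_n, forall v, quadf A v = \sum_(u <- us) dotv u v ^+ 2.
Proof.
elim: k A => [|k IHk] A psdA A0.
  exists [::] => v; rewrite big_nil.
  have -> : A = 0 by apply/matrixP => i j; rewrite A0 ?mxE.
  exact: quadf0l.
have [ltkn|lenk] := ltnP k n; last first.
  by apply: IHk => // i; rewrite leqNgt (leq_trans (ltn_ord i) lenk).
pose i := Ordinal ltkn; have [symA A_ge0] := psdA.
have [Aii|Aii] := eqVneq (A i i) 0.
  apply: IHk => // j l; rewrite leq_eqVlt => /predU1P[kj|]; last exact: A0.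
  have -> : j = i by exact/val_inj/esym.
  exact: psdmx_row0.
have Aii_gt0 : 0 < A i i by rewrite lt_def Aii -quadf_delta A_ge0.
pose c := col i A; pose A' := A - (A i i)^-1 *: (c *m c^T).
have quadA' v : quadf A' v = quadf A v - (A i i)^-1 * dotv c v ^+ 2.
  by rewrite quadfDl quadfNl quadfZl quadf_outer expr2.
have symc j : A i j = A j i by exact: symmxE.
have [||us usE] := IHk A'.
- split.
    by rewrite /A' linearB linearZ /= trmx_mul trmxK symA.
  move=> v; rewrite quadA'.
  (* The minimizing translate of v. *)
  have := A_ge0 (v + (- (dotv c v / A i i)) *: delta_mx i 0).
  rewrite quadfD // dotvZr quadfZr quadf_delta dotv_delta.
  have -> : (A *m v) i 0 = dotv c v.
    by rewrite -dotv_delta dotvC dotv_mulmx symA -colE.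
  congr (0 <= _); field; exact: Aii.
- move=> j l kj; rewrite !mxE big_ord1 !mxE.
  move: kj; rewrite leq_eqVlt => /predU1P[kj|kj]; last first.
    by rewrite !(A0 j) // mul0r mulr0 subr0.
  have -> : j = i by exact/val_inj/esym.
  by rewrite mulKf // symc subrr.
exists (Num.sqrt (A i i)^-1 *: c :: us) => v.
rewrite big_cons -usE quadA' dotvZl exprMn sqr_sqrtr ?invr_ge0 ?ltW //.
by rewrite addrC subrK.
Qed.

Lemma psdmx_sos A : psdmx A ->
  exists us : seq 'cV[R]_n, forall v, quadf A v = \sum_(u <- us) dotv u v ^+ 2.
Proof.
by move=> psdA; apply: (@psdmx_sos_rec n) => // i j; rewrite leqNgt ltn_ord.
Qed.

(** * The cubic tensor form *)

Lemma tensor_mx_sym T s : symtensor3 T -> (tensor_mx T s)^T = tensor_mx T s.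
Proof.
move=> symT; apply/matrixP => i j; rewrite !mxE; apply: eq_bigr => k _.
by rewrite (symT i j k).1.
Qed.

Lemma tensor_mxD T x y : tensor_mx T (x + y) = tensor_mx T x + tensor_mx T y.
Proof.
apply/matrixP => i j; rewrite !mxE -big_split; apply: eq_bigr => k _.
by rewrite !mxE mulrDr.
Qed.

Lemma tensor_mxZ T a x : tensor_mx T (a *: x) = a *: tensor_mx T x.
Proof.
apply/matrixP => i j; rewrite !mxE mulr_sumr; apply: eq_bigr => k _.
by rewrite !mxE mulrCA.
Qed.

Lemma tensor_mxC T x y :
  symtensor3 T -> tensor_mx T x *m y = tensor_mx T y *m x.
Proof.
move=> symT; apply/matrixP => i j; rewrite ord1 !mxE.
under eq_bigr => k _ do rewrite mxE mulr_suml.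
rewrite exchange_big; apply: eq_bigr => k _; rewrite mxE mulr_suml.
by apply: eq_bigr => l _; rewrite mulrAC (symT i l k).2.
Qed.

Lemma cubicfE T s : cubicf T s = quadf (tensor_mx T s) s.
Proof.
rewrite quadfE dotvE; apply: eq_bigr => i _; rewrite mxE mulr_sumr.
apply: eq_bigr => j _; rewrite mxE mulr_suml mulr_sumr.
by apply: eq_bigr => k _; ring.
Qed.

Lemma cubicfZ T a s : cubicf T (a *: s) = a ^+ 3 * cubicf T s.
Proof. by rewrite !cubicfE tensor_mxZ quadfZl quadfZr mulrA -exprS. Qed.

Lemma cubicfD T x y : symtensor3 T ->
  cubicf T (x + y) = cubicf T x + 3 * dotv (tensor_mx T x *m x) y
                     + 3 * quadf (tensor_mx T x) y + cubicf T y.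
Proof.
move=> symT; rewrite !cubicfE tensor_mxD quadfDl.
rewrite !quadfD ?tensor_mx_sym // (tensor_mxC y x) //.
have -> : quadf (tensor_mx T y) x = dotv (tensor_mx T x *m x) y.
  by rewrite quadfE tensor_mxC // dotv_mulmx tensor_mx_sym.
have -> : dotv (tensor_mx T x *m y) y = quadf (tensor_mx T x) y.
  by rewrite dotvC -quadfE.
ring.
Qed.

(** * Taylor expansion and gradient of the model *)

(** A difference quotient that is polynomial in the step has its value at 0
    as limit; this gives the gradient of the model from its Taylor expansion
    alone. *)
Lemma derive_horner (f : 'cV[R]_n -> R) (a v : 'cV[R]_n) (p : {poly R}) :
  (forall h, f (a + h *: v) - f a = h * p.[h]) -> 'D_v f a = p.[0].
Proof.
move=> fE; rewrite /derive; apply: cvg_lim => //.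
apply: (@cvg_trans _ (horner p @ 0^')%classic); last first.
  apply: cvg_within_filter; exact: continuous_horner.
apply: near_eq_cvg; near=> h.
rewrite /= (addrC (h *: v)) fE; symmetry; apply: mulKf.
near: h; exact: nbhs_dnbhs_neq.
Unshelve. all: by end_near. Qed.

Definition m3_grad g A T sigma s : 'cV[R]_n :=
  g + A *m s + 2^-1 *: (tensor_mx T s *m s) + (sigma * dotv s s) *: s.

Lemma m3_taylor f0 g A T sigma s v : A^T = A -> symtensor3 T ->
  m3 f0 g A T sigma (s + v) - m3 f0 g A T sigma s =
    dotv (m3_grad g A T sigma s) v
    + (2^-1 * quadf (A + tensor_mx T s + (sigma * dotv s s)%:M) v
       + sigma * dotv s v ^+ 2)
    + (6^-1 * cubicf T v + sigma * dotv s v * dotv v v)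
    + sigma / 4 * dotv v v ^+ 2.
Proof.
move=> symA symT; rewrite /m3 /m3_grad !(exprM _ 2 2) !enorm_sqr.
rewrite quadfD // cubicfD // !quadfDl quadf_scalar !(dotvDl, dotvDr, dotvZl).
by rewrite (dotvC v s); field.
Qed.

Lemma m3_gradient f0 g A T sigma s : A^T = A -> symtensor3 T ->
  gradient (m3 f0 g A T sigma) s = m3_grad g A T sigma s.
Proof.
move=> symA symT; apply/matrixP => i j; rewrite ord1 mxE -dotv_delta.
set v : 'cV[R]_n := delta_mx i 0.
pose c2 := 2^-1 * quadf (A + tensor_mx T s + (sigma * dotv s s)%:M) v
           + sigma * dotv s v ^+ 2.
pose c3 := 6^-1 * cubicf T v + sigma * dotv s v * dotv v v.
pose c4 := sigma / 4 * dotv v v ^+ 2.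
rewrite (@derive_horner _ _ _
  ((dotv (m3_grad g A T sigma s) v)%:P + c2 *: 'X + c3 *: 'X^2 + c4 *: 'X^3)).
  by rewrite !hornerE /= !mulr0 !addr0.
move=> h; rewrite m3_taylor // quadfZr cubicfZ !dotvZr dotvZl !hornerE /=.
rewrite /c2 /c3 /c4; ring.
Qed.

(** * Decomposition of the cubic form over pairs of indices *)

Lemma sum_ltn_pairs (F : 'I_n -> 'I_n -> R) : (forall i j, F i j = F j i) ->
  \sum_(i < n) \sum_(j < n | (i < j)%N) F i j =
  2^-1 * (\sum_i \sum_j F i j - \sum_i F i i).
Proof.
move=> symF.
have upE : \sum_(i < n) \sum_(j < n | (j < i)%N) F i j =
           \sum_(i < n) \sum_(j < n | (i < j)%N) F i j.
  rewrite (exchange_big_dep predT) //=; apply: eq_bigr => i _.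
  by apply: eq_bigr => j _; rewrite symF.
have -> : \sum_i \sum_j F i j = \sum_i (F i i
    + (\sum_(j < n | (i < j)%N) F i j + \sum_(j < n | (j < i)%N) F i j)).
  apply: eq_bigr => i _; rewrite (bigD1 i) //=; congr (_ + _).
  rewrite (bigID (fun j : 'I_n => (i < j)%N)) /=; congr (_ + _).
    apply: eq_bigl => j; rewrite -val_eqE /=; lia.
  apply: eq_bigl => j; rewrite -val_eqE /=; lia.
rewrite !big_split /= upE; by field.
Qed.

Lemma dotv_swapvec s v i j : i != j ->
  dotv (swapvec s i j) v = s j 0 * v i 0 + s i 0 * v j 0.
Proof.
move=> ij; rewrite dotvE (bigD1 i) //= (bigD1 j) ?(eq_sym j) //=.
rewrite !mxE !eqxx (eq_sym j) (negbTE ij) big1 ?addr0 // => k /andP[ki kj].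
by rewrite mxE (negbTE ki) (negbTE kj) mul0r.
Qed.

(** The entries i and j of bvec are split as a value of T that completes the
    sum over k, plus a correction; the right-hand side then makes sense and
    is symmetric for all i and j, so that sum_ltn_pairs applies to it. *)
Lemma dotv_bvec T v i j : symtensor3 T -> i != j ->
  dotv (bvec T i j) v = 3^-1 * (\sum_k T i j k * v k 0)
    + 6^-1 * ((T i i j - T j j j) * v i 0 + (T j j i - T i i i) * v j 0).
Proof.
move=> symT ij; have ji : j != i by rewrite eq_sym.
have split2 (F : 'I_n -> R) :
    \sum_k F k = F i + (F j + \sum_(k < n | (k != i) && (k != j)) F k).
  by rewrite (bigD1 i) //= (bigD1 j).
rewrite dotvE !split2 !mxE !eqxx (negbTE ji).
have -> : \sum_(k < n | (k != i) && (k != j)) bvec T i j k 0 * v k 0 =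
    3^-1 * \sum_(k < n | (k != i) && (k != j)) T i j k * v k 0.
  rewrite mulr_sumr; apply: eq_bigr => k /andP[ki kj].
  by rewrite mxE (negbTE ki) (negbTE kj); field.
have -> : T i j i = T i i j by rewrite (symT i j i).2.
have -> : T j j i = T i j j by rewrite (symT j j i).2 (symT j i j).1.
by field.
Qed.

(** By symmetry of the summand, the sum over i < j is half the sum over all
    (i, j) minus the diagonal.  In the full sum, the entries T_jjj assemble
    into |v|^2 (t.v), and the entries T_iij into the sum D below, which
    is exactly cancelled by the diagonal. *)
Lemma cubicf_decomp T v : symtensor3 T ->
  6^-1 * cubicf T v = dotv v v * dotv (tvec T) v
    + \sum_(i < n) \sum_(j < n | (i < j)%N)
        v i 0 * v j 0 * dotv (bvec T i j) v.
Proof.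
move=> symT.
pose P i j := \sum_k T i j k * v k 0.
pose Q i j := (T i i j - T j j j) * v i 0.
pose F i j := v i 0 * v j 0 * (3^-1 * P i j + 6^-1 * (Q i j + Q j i)).
have symF i j : F i j = F j i.
  rewrite /F (_ : P i j = P j i).
    by rewrite (addrC (Q i j)) (mulrC (v i 0)).
  by apply: eq_bigr => k _; rewrite (symT i j k).1.
pose D := \sum_i v i 0 ^+ 2 * P i i.
have -> : \sum_(i < n) \sum_(j < n | (i < j)%N)
            v i 0 * v j 0 * dotv (bvec T i j) v =
          \sum_(i < n) \sum_(j < n | (i < j)%N) F i j.
  apply: eq_bigr => i _; apply: eq_bigr => j ij.
  by rewrite dotv_bvec // -val_eqE neq_ltn ij.
rewrite (sum_ltn_pairs symF).
have cubicP : cubicf T v = \sum_i \sum_j v i 0 * v j 0 * P i j.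
  apply: eq_bigr => i _; apply: eq_bigr => j _; rewrite mulr_sumr.
  by apply: eq_bigr => k _; ring.
have sumQ : \sum_i \sum_j v i 0 * v j 0 * Q i j =
            D - 6 * (dotv v v * dotv (tvec T) v).
  rewrite !dotvE mulr_suml mulr_sumr -sumrB; apply: eq_bigr => i _.
  rewrite /P !mulr_sumr -sumrB; apply: eq_bigr => j _.
  by rewrite /Q mxE; field.
have sumF : \sum_i \sum_j F i j =
    3^-1 * cubicf T v + 3^-1 * (D - 6 * (dotv v v * dotv (tvec T) v)).
  have -> : 3^-1 * (D - 6 * (dotv v v * dotv (tvec T) v)) =
      6^-1 * (\sum_i \sum_j v i 0 * v j 0 * Q i j)
      + 6^-1 * (\sum_i \sum_j v i 0 * v j 0 * Q j i).
    have -> : \sum_i \sum_j v i 0 * v j 0 * Q j i =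
              \sum_i \sum_j v i 0 * v j 0 * Q i j.
      rewrite exchange_big; apply: eq_bigr => i _; apply: eq_bigr => j _.
      by rewrite (mulrC (v i 0)).
    by rewrite sumQ; field.
  rewrite cubicP !mulr_sumr -!big_split; apply: eq_bigr => i _ /=.
  rewrite !mulr_sumr -!big_split; apply: eq_bigr => j _ /=.
  by rewrite /F; ring.
have diagF : \sum_i F i i = 3^-1 * D.
  rewrite mulr_sumr; apply: eq_bigr => i _.
  by rewrite /F /Q subrr; ring.
by rewrite sumF diagF; field.
Qed.

(** The full sum over (i, j) factors into dot products; its diagonal is the sum
    of squares that appears last in the certificate. *)
Lemma sum_pair_squares s v :
  \sum_(i < n) \sum_(j < n | (i < j)%N)
     (s j 0 * v i 0 + s i 0 * v j 0 + v i 0 * v j 0) ^+ 2 =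
  dotv s s * dotv v v + dotv s v ^+ 2 + 2 * (dotv v v * dotv s v)
  + 2^-1 * dotv v v ^+ 2
  - 2^-1 * \sum_i (2 * s i 0 * v i 0 + v i 0 ^+ 2) ^+ 2.
Proof.
rewrite (sum_ltn_pairs
  (F := fun i j => (s j 0 * v i 0 + s i 0 * v j 0 + v i 0 * v j 0) ^+ 2)).
  have prodE (a b c d : 'cV[R]_n) : dotv a b * dotv c d =
      \sum_i \sum_j a i 0 * b i 0 * (c j 0 * d j 0).
    rewrite !dotvE mulr_suml; apply: eq_bigr => i _; by rewrite mulr_sumr.
  have -> : \sum_i \sum_j
      (s j 0 * v i 0 + s i 0 * v j 0 + v i 0 * v j 0) ^+ 2 =
      dotv v v * dotv s s + dotv s s * dotv v v + dotv v v * dotv v v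
      + 2 * (dotv s v * dotv s v) + 2 * (dotv v v * dotv s v)
      + 2 * (dotv s v * dotv v v).
    rewrite !prodE !mulr_sumr -!big_split; apply: eq_bigr => i _ /=.
    rewrite !mulr_sumr -!big_split; apply: eq_bigr => j _ /=.
    by ring.
  have -> : \sum_i (s i 0 * v i 0 + s i 0 * v i 0 + v i 0 * v i 0) ^+ 2 =
      \sum_i (2 * s i 0 * v i 0 + v i 0 ^+ 2) ^+ 2.
    by apply: eq_bigr => i _; ring.
  by field.
by move=> i j; ring.
Qed.

(** * The sum-of-squares identity *)

Lemma quadf_Bmx A T sigma nu s v :
  quadf (Bmx A T sigma nu s) v =
  quadf (A + tensor_mx T s + (sigma * dotv s s)%:M) v
  - nu * (dotv s s * dotv v v - dotv s v ^+ 2)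
  - 2 / (sigma - nu) * dotv (tvec T) v ^+ 2
  - 4 * (dotv s v * dotv (tvec T) v)
  - \sum_(i < n) \sum_(j < n | (i < j)%N)
      (2 * ((s j 0 * v i 0 + s i 0 * v j 0) * dotv (bvec T i j) v)
       + nu^-1 * dotv (bvec T i j) v ^+ 2).
Proof.
rewrite /Bmx !enorm_sqr !(quadfDl, quadfNl, quadfZl, quadf_scalar, quadf_outer).
rewrite quadf_sum; congr (_ - _); first by ring.
apply: eq_bigr => i _; rewrite quadf_sum; apply: eq_bigr => j ij.
rewrite !(quadfDl, quadfZl, quadf_outer) dotv_swapvec; first by ring.
by rewrite -val_eqE neq_ltn ij.
Qed.

(** Half of Bmx is what remains of the degree-two part of the expansion once
    the degree-two parts of the squares are removed; the squares alone account
    for degrees three and four. *)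
Lemma m3_certificate f0 g A T sigma nu s v :
  A^T = A -> symtensor3 T -> nu != 0 -> sigma - nu != 0 ->
  m3 f0 g A T sigma (s + v) - m3 f0 g A T sigma s =
    dotv (m3_grad g A T sigma s) v
    + 2^-1 * quadf (Bmx A T sigma nu s) v
    + (sigma - nu)^-1 *
        (dotv (tvec T) v + (sigma - nu) * (dotv s v + 2^-1 * dotv v v)) ^+ 2
    + \sum_(i < n) \sum_(j < n | (i < j)%N) (2 * nu)^-1 *
        (dotv (bvec T i j) v
         + nu * (s j 0 * v i 0 + s i 0 * v j 0 + v i 0 * v j 0)) ^+ 2
    + nu / 4 * \sum_i (2 * s i 0 * v i 0 + v i 0 ^+ 2) ^+ 2.
Proof.
move=> symA symT nu0 sn0.
rewrite m3_taylor // quadf_Bmx cubicf_decomp //.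
set qA := quadf _ v; set t := tvec T.
(* Expanding the pair squares isolates the cubic terms of cubicf_decomp, the
   quadratic terms subtracted in Bmx, and the sum of sum_pair_squares. *)
have -> : \sum_(i < n) \sum_(j < n | (i < j)%N) (2 * nu)^-1 *
        (dotv (bvec T i j) v
         + nu * (s j 0 * v i 0 + s i 0 * v j 0 + v i 0 * v j 0)) ^+ 2 =
  2^-1 * (\sum_(i < n) \sum_(j < n | (i < j)%N)
      (2 * ((s j 0 * v i 0 + s i 0 * v j 0) * dotv (bvec T i j) v)
       + nu^-1 * dotv (bvec T i j) v ^+ 2))
  + \sum_(i < n) \sum_(j < n | (i < j)%N)
        v i 0 * v j 0 * dotv (bvec T i j) v
  + nu / 2 * \sum_(i < n) \sum_(j < n | (i < j)%N)
     (s j 0 * v i 0 + s i 0 * v j 0 + v i 0 * v j 0) ^+ 2.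
  rewrite !mulr_sumr -!big_split; apply: eq_bigr => i _ /=.
  rewrite !mulr_sumr -!big_split; apply: eq_bigr => j _ /=.
  by field.
rewrite sum_pair_squares.
by field; rewrite ?nu0 ?sn0.
Qed.

(** * Sums of squares of polynomials *)

Definition polyfun (f : 'cV[R]_n -> R) : Prop :=
  exists p : mpoly.mpoly n R, forall v, f v = mpoly.meval (fun i => v i 0) p.

Lemma polyfun_const a : polyfun (fun=> a).
Proof. by exists (mpoly.mpolyC n a) => v; rewrite mpoly.mevalC. Qed.

Lemma polyfun_coord i : polyfun (fun v => v i 0).
Proof.
by exists (mpoly.mpolyX R (mpoly.mnm1 i)) => v; rewrite mpoly.mevalXU.
Qed.

Lemma polyfunD (f h : 'cV[R]_n -> R) :
  polyfun f -> polyfun h -> polyfun (fun v => f v + h v).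
Proof.
by move=> [p fp] [q hq]; exists (p + q) => v; rewrite mpoly.mevalD fp hq.
Qed.

Lemma polyfunM (f h : 'cV[R]_n -> R) :
  polyfun f -> polyfun h -> polyfun (fun v => f v * h v).
Proof.
by move=> [p fp] [q hq]; exists (p * q) => v; rewrite mpoly.mevalM fp hq.
Qed.

Lemma polyfun_sum (I : Type) (r : seq I) (f : I -> 'cV[R]_n -> R) :
  (forall i, polyfun (f i)) -> polyfun (fun v => \sum_(i <- r) f i v).
Proof.
move=> fP; elim: r => [|i r IHr].
  by have [p p0] := polyfun_const 0; exists p => v; rewrite big_nil -p0.
have [p fp] := polyfunD (fP i) IHr.
by exists p => v; rewrite big_cons -fp.
Qed.

Lemma polyfun_dotv (f h : 'cV[R]_n -> 'cV[R]_n) :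
  (forall i, polyfun (fun v => f v i 0)) ->
  (forall i, polyfun (fun v => h v i 0)) -> polyfun (fun v => dotv (f v) (h v)).
Proof.
move=> fP hP.
have [p fp] := polyfun_sum (index_enum 'I_n) (fun i => polyfunM (fP i) (hP i)).
by exists p => v; rewrite dotvE -fp.
Qed.

Lemma polyfun_linear u : polyfun (dotv u).
Proof.
by apply: polyfun_dotv => i; [exact: polyfun_const | exact: polyfun_coord].
Qed.

Lemma eq_is_sos (q r : 'cV[R]_n -> R) : q =1 r -> is_sos r -> is_sos q.
Proof. by move=> qr [ps rE]; exists ps => v; rewrite qr. Qed.

Lemma is_sos_sqr (f : 'cV[R]_n -> R) :
  polyfun f -> is_sos (fun v => f v ^+ 2).
Proof. by move=> [p fp]; exists [:: p] => v; rewrite big_seq1 fp. Qed.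

Lemma is_sosD (q r : 'cV[R]_n -> R) :
  is_sos q -> is_sos r -> is_sos (fun v => q v + r v).
Proof.
by move=> [ps qE] [pt rE]; exists (ps ++ pt) => v; rewrite big_cat qE rE.
Qed.

Lemma is_sosZ a (q : 'cV[R]_n -> R) :
  0 <= a -> is_sos q -> is_sos (fun v => a * q v).
Proof.
move=> a0 [ps qE]; exists [seq Num.sqrt a *: p | p <- ps] => v.
rewrite qE mulr_sumr big_map; apply: eq_bigr => p _.
by rewrite mpoly.mevalZ exprMn sqr_sqrtr.
Qed.

Lemma is_sos_sum (I : Type) (r : seq I) (P : pred I) (q : I -> 'cV[R]_n -> R) :
  (forall i, is_sos (q i)) -> is_sos (fun v => \sum_(i <- r | P i) q i v).
Proof.
move=> qP; elim: r => [|i r [ps IHr]].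
  by exists [::] => v; rewrite !big_nil.
have [pt qE] := qP i; exists (if P i then pt ++ ps else ps) => v.
by rewrite big_cons; case: (P i); rewrite // big_cat -qE -IHr.
Qed.

Lemma is_sos_ge0 (q : 'cV[R]_n -> R) v : is_sos q -> 0 <= q v.
Proof. by move=> [ps ->]; apply: sumr_ge0 => p _; exact: sqr_ge0. Qed.

Lemma is_sos_quadf A : psdmx A -> is_sos (quadf A).
Proof.
move=> /psdmx_sos[us usE]; apply: eq_is_sos usE _.
by apply: is_sos_sum => u; apply: is_sos_sqr; exact: polyfun_linear.
Qed.

End Forms.

(** * The global optimality condition *)

Theorem theorem2p1 (R : realType) (n : nat) (hn : (1 <= n)%N)
    (f0 : R) (g : 'cV[R]_n) (H : 'M[R]_n) (T : tensor3 R n) (sigma nu : R)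
    (symH : H^T = H) (symT : symtensor3 T)
    (nu_gt0 : 0 < nu) (nu_lt_sigma : nu < sigma)
    (sstar : 'cV[R]_n)
    (grad0 : gradient (m3 f0 g H T sigma) sstar = 0)
    (Bpsd : psdmx (Bmx H T sigma nu sstar)) :
  is_sos (fun v : 'cV[R]_n =>
            m3 f0 g H T sigma (sstar + v) - m3 f0 g H T sigma sstar)
  /\ (forall s : 'cV[R]_n, m3 f0 g H T sigma sstar <= m3 f0 g H T sigma s).
Proof.
set q := fun v => _.
suff sosq : is_sos q.
  split=> // s; have := is_sos_ge0 (s - sstar) sosq.
  by rewrite /q subrKC subr_ge0.
have sn_gt0 : 0 < sigma - nu by rewrite subr_gt0.
rewrite m3_gradient // in grad0.
apply: eq_is_sos => [v|].
  rewrite /q (m3_certificate _ _ _ _ symH symT (lt0r_neq0 nu_gt0)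
    (lt0r_neq0 sn_gt0)) grad0.
  rewrite {1}dotvE big1 => [|i _]; last by rewrite mxE mul0r.
  rewrite add0r; reflexivity.
have lin := polyfun_linear; have coord := @polyfun_coord R n.
have cst := @polyfun_const R n.
apply: is_sosD; [apply: is_sosD; [apply: is_sosD |] |].
- apply: is_sosZ; last exact: is_sos_quadf.
  by rewrite invr_ge0 ler0n.
- apply: is_sosZ; first by rewrite invr_ge0 ltW.
  apply: is_sos_sqr; apply: polyfunD => //; apply: polyfunM => //.
  apply: polyfunD => //; apply: polyfunM => //; exact: polyfun_dotv.
- apply: is_sos_sum => i; apply: is_sos_sum => j.
  apply: is_sosZ; first by rewrite invr_ge0 mulr_ge0 ?ler0n ?ltW.
  apply: is_sos_sqr; apply: polyfunD => //; apply: polyfunM => //.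
  by apply: polyfunD; [apply: polyfunD|]; apply: polyfunM.
- apply: is_sosZ; first by rewrite divr_ge0 ?ler0n ?ltW.
  apply: is_sos_sum => i; apply: is_sos_sqr.
  by apply: polyfunD; apply: polyfunM => //; apply: polyfunM.
Qed.
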